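(* Let $q$ be a prime power. For $n\ge 2$ let $E_n$ denote the expected excess of irreducible versus reducible quadratic factors of a uniformly random monic degree $n$ square-free polynomial $P$ over $F_q$, i.e. the expected value of $$n_2(P)-\binom{n_1(P)}{2}.$$ Then: (1) For fixed $q$, as $n\to\infty$, $$E_n \longrightarrow \frac{1}{q}\,\frac{1-1/q}{(1+1/q)^2(1+1/q^2)}.$$ (2) $E_2=0$, $E_3=1/q$, and for all $n\ge 4$, $$E_n=\left[\sum_{i=1}^{n-3}\frac{(-1)^{i+1}a_i}{q^i}\right]-\frac{(-1)^n\, b_{n-3}}{q^{n-2}}.$$ Here $a_1,a_2,a_3,\dots$ is the sequence $1,3,4,4,5,7,8,8,9,11,12,12,13,15,16,16,\dots$ (the odd numbers with two times the positive even numbers repeated in order between them), that is, for $k\ge 0$: $a_{4k+1}=4k+1$, $a_{4k+2}=4k+3$, $a_{4k+3}=a_{4k+4}=4k+4$; and $b_1,b_2,b_3,\dots$ is the sequence $2,2,2,3,4,4,4,5,6,6,6,7,8,8,8,9,\dots$ (three equal even numbers followed by one odd number), that is, for $k\ge 0$: $b_{4k+1}=b_{4k+2}=b_{4k+3}=2k+2$, $b_{4k+4}=2k+3$.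
   Context: $F_q$ is the finite field with $q$ elements. A random monic degree $n$ square-free polynomial is chosen uniformly from the finite set of monic degree $n$ square-free polynomials with coefficients in $F_q$. For such a polynomial $P$, $n_i(P)$ denotes the number of monic irreducible factors of $P$ over $F_q$ of degree $i$. Thus $n_2(P)$ is the number of irreducible quadratic factors and $\binom{n_1(P)}{2}$ is the number of reducible (monic) quadratic factors of $P$. *)

(* Defs.v *)
From HB Require Import structures.
From mathcomp Require Import all_boot all_order all_algebra.
From mathcomp Require Import all_classical all_reals all_analysis.

Set Implicit Arguments.
Unset Strict Implicit.
Unset Printing Implicit Defensive.

Import Order.TTheory GRing.Theory Num.Theory.
Import numFieldNormedType.Exports.

Local Open Scope ring_scope.

(* [u] ranges over all polynomials that are not nonzero constants; the case
   [u = 0] only rules out [P = 0]. *)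
Definition square_free (F : fieldType) (P : {poly F}) : Prop :=
  forall u : {poly F}, size u != 1%N -> ~~ (u ^+ 2 %| P).

(* [{poly_n.+1 F}] is the finite type of polynomials of degree at most [n];
   [size] is one plus the degree. *)
Definition monic_square_free (F : finFieldType) (n : nat) :
    {set {poly_n.+1 F}} :=
  [set P : {poly_n.+1 F} | [&& polyn P \is monic, size P == n.+1
                             & `[< square_free (polyn P) >]]].

Definition nb_irr_factors (F : finFieldType) (i : nat) (P : {poly F}) : nat :=
  #|[set Q : {poly_i.+1 F} | [&& polyn Q \is monic, size Q == i.+1,
                               irreducibleb Q & polyn Q %| P]]|.

Definition excess (R : realType) (F : finFieldType) (P : {poly F}) : R :=
  (nb_irr_factors 2 P)%:R - 'C(nb_irr_factors 1 P, 2)%:R.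

Definition expected_excess (R : realType) (F : finFieldType) (n : nat) : R :=
  (\sum_(P in monic_square_free F n) excess R P) / #|monic_square_free F n|%:R.

(* Both sequences are indexed from 1; the value at 0 is irrelevant.
   With [k = (i - 1) / 4], the four entries are the values at
   [i = 4k+1, 4k+2, 4k+3, 4k+4]. *)
Definition seq_a (i : nat) : nat :=
  let k := (i.-1 %/ 4)%N in
  nth 0%N [:: 4 * k + 1; 4 * k + 3; 4 * k + 4; 4 * k + 4]%N (i.-1 %% 4)%N.

Definition seq_b (i : nat) : nat :=
  let k := (i.-1 %/ 4)%N in
  nth 0%N [:: 2 * k + 2; 2 * k + 2; 2 * k + 2; 2 * k + 3]%N (i.-1 %% 4)%N.

(* Main.v *)
Require Import Defs.
From HB Require Import structures.
From mathcomp Require Import all_boot all_order all_algebra.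
From mathcomp Require Import all_classical all_reals all_analysis.
From mathcomp Require Import ring lra zify.
Set Implicit Arguments.
Unset Strict Implicit.
Unset Printing Implicit Defensive.
Import Order.TTheory GRing.Theory Num.Theory.
Import numFieldNormedType.Exports.

(** Write [q] for the cardinality of [F] and [S n] for the number of monic
    square-free polynomials of degree [n].  Every monic polynomial is uniquely
    [A ^+ 2 * B] with [A] monic and [B] square-free, so that
    [q ^ n = \sum_k q ^ k * S (n - 2 k)], whence [S 0 = 1], [S 1 = q] and
    [S (n + 2) = q ^ (n + 2) - q ^ (n + 1)] ([nb_sqfreeSS]).

    If [Q] is irreducible of degree [d], the square-free multiples of [Q] are
    the [Q * P] with [P] square-free and not divisible by [Q]
    ([sqfreeM_irred]).  Hence the number of square-free multiples of [Q] of
    degree [d + n], plus that of degree [n], is [S n].  Summing over [Q], and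
    over pairs of linear [Q], gives linear recurrences for the total numbers
    of irreducible factors of degree [d] ([sum_irr_factors_rec]) and of pairs
    of distinct linear factors ([sum_linear_pairs_rec]).  Since there are
    [q (q - 1) / 2] irreducible quadratic polynomials, as many as pairs of
    distinct linear ones, the total excess divided by [q (q - 1)] is a
    sequence [e] with [e 0 = e 1 = e 2 = 0], [e 3 = 1] and
    [e (n+4) + 2 e (n+3) + 2 e (n+2) + 2 e (n+1) + e n = S (n + 1)],
    while the expected excess in degree [n + 2] is [e (n + 2) / q ^ n].

    In terms of generating series in [T], the recurrence says that [e] is
    [T ^ 3 * S / ((1 + T) ^ 2 * (1 + T ^ 2))] where
    [S = (1 - q T ^ 2) / (1 - q T)].  Up to signs, the numbers [b_m] are the
    coefficients of [1 / ((1 + T) ^ 2 * (1 + T ^ 2))] and the [a_m] are the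
    sums of two consecutive ones; multiplying by [1 - q T] yields a first-order
    recurrence for [e] ([closed_form_step]) that sums to the explicit formula
    ([closed_form]).

    For the limit, divide the recurrence by [q ^ n]: with [T] read as the
    backward shift, its operator factors into [1 + T / q], twice, and
    [1 + (T / q) ^ 2].  Since [1 / q < 1], a sequence converges as soon as its
    image under one of these factors does ([damped_recurrence_cvg]). *)

Local Open Scope classical_set_scope.
Local Open Scope ring_scope.

(** * Monic polynomials of a given degree *)

Section MonicPolynomials.
Variable F : finFieldType.
Implicit Types P Q A B C D L : {poly F}.

Definition monics n : seq {poly F} :=
  [seq 'X^n + rVpoly v | v <- enum 'rV[F]_n].

Lemma mem_monics n P : (P \in monics n) = (P \is monic) && (size P == n.+1).
Proof.
have szv (v : 'rV[F]_n) : (size (rVpoly v) < size ('X^n : {poly F}))%N.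
  by rewrite size_polyXn ltnS size_poly.
apply/mapP/andP=> [[v _ ->]|[mP /eqP sP]].
  by rewrite monicE lead_coefDl // lead_coefXn size_polyDl // size_polyXn.
exists (poly_rV (P - 'X^n)); first by rewrite mem_enum.
have sz : (size (P - 'X^n)%R <= n)%N.
  apply/leq_sizeP => j; rewrite leq_eqVlt => /predU1P[<-|ltnj].
    move: mP; rewrite monicE lead_coefE sP /= => /eqP mP.
    by rewrite coefB coefXn eqxx mP subrr.
  by rewrite coefB coefXn (gtn_eqF ltnj) nth_default ?sP // subr0.
by rewrite poly_rV_K // addrC subrK.
Qed.

Lemma monics_uniq n : uniq (monics n).
Proof.
rewrite map_inj_uniq ?enum_uniq // => u v /addrI.
exact: (can_inj (@rVpolyK _ _)).
Qed.

Lemma size_monics n : size (monics n) = (#|F| ^ n)%N.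
Proof. by rewrite size_map -cardE card_mx mul1n. Qed.

Lemma monics0 : monics 0 = [:: 1].
Proof.
suff: perm_eq (monics 0) [:: 1] by move/perm_small_eq=> ->.
apply: uniq_perm => [||P]; rewrite ?monics_uniq //.
rewrite mem_monics inE; apply/andP/eqP => [[mP /size_poly1P[c _ Pc]]|->].
  by move: mP; rewrite Pc monicE lead_coefC => /eqP ->.
by rewrite monic1 size_poly1.
Qed.

Lemma monics_monic n P : P \in monics n -> P \is monic.
Proof. by rewrite mem_monics => /andP[]. Qed.

Lemma monics_size n P : P \in monics n -> size P = n.+1.
Proof. by rewrite mem_monics => /andP[_ /eqP]. Qed.

Lemma monics_neq0 n P : P \in monics n -> P != 0.
Proof. by move/monics_monic/monic_neq0. Qed.

Lemma mem_monicsM d n Q P :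
  Q \in monics d -> (Q * P \in monics (d + n)) = (P \in monics n).
Proof.
rewrite !mem_monics => /andP[mQ /eqP sQ]; rewrite monicMl //.
case: (boolP (P \is monic)) => //= mP; rewrite size_Mmonic ?monic_neq0 // sQ.
by rewrite addSn /= -addnS eqn_add2l.
Qed.

(** Passing from the finite type of bounded polynomials to a list of plain
    polynomials allows different degrees to be compared. *)
Lemma big_bounded_monic (T : Type) (idx : T) (op : Monoid.com_law idx)
    n (p : pred {poly F}) (f : {poly F} -> T) :
  \big[op/idx]_(P : {poly_n.+1 F} |
      [&& polyn P \is monic, size P == n.+1 & p (polyn P)]) f (polyn P)
  = \big[op/idx]_(P <- monics n | p P) f P.
Proof.
rewrite -[RHS]big_filter.
transitivity (\big[op/idx]_(P <- map (@polyn F n.+1) (enum {poly_n.+1 F})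
                   | [&& P \is monic, size P == n.+1 & p P]) f P).
  by rewrite big_map big_enum_cond.
rewrite -big_filter; apply/perm_big/uniq_perm.
- by rewrite filter_uniq // map_inj_uniq ?enum_uniq //; apply: val_inj.
- by rewrite filter_uniq // monics_uniq.
move=> P; rewrite !mem_filter mem_monics andbC.
apply/andP/and3P => [[_ /and3P[]]//|[pP mP sP]]; split; last by apply/and3P.
have sP' : P \is a poly_of_size n.+1 by rewrite qualifE /= (eqP sP).
by apply/mapP; exists (NPoly sP'); rewrite ?mem_enum.
Qed.

Lemma big_monics_dvd (T : Type) (idx : T) (op : Monoid.com_law idx) d n Q
    (f : {poly F} -> T) : Q \in monics d ->
  \big[op/idx]_(P <- monics (d + n) | Q %| P) f P
  = \big[op/idx]_(P <- monics n) f (Q * P).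
Proof.
move=> Qd; have Q0 := monics_neq0 Qd.
transitivity (\big[op/idx]_(P <- [seq Q * P | P <- monics n]) f P);
  last by rewrite big_map.
rewrite -[LHS]big_filter; apply/perm_big/uniq_perm.
- by rewrite filter_uniq // monics_uniq.
- by rewrite map_inj_uniq ?monics_uniq // => u v /(mulfI Q0).
move=> P; rewrite mem_filter; apply/andP/mapP => [[/dvdpP[R ->]]|[R Rn ->]].
  by rewrite mulrC (mem_monicsM _ _ Qd) => Rn; exists R.
by rewrite dvdp_mulIl (mem_monicsM _ _ Qd).
Qed.

Lemma monics_ndvd d n Q P :
  (n < d)%N -> Q \in monics d -> P \in monics n -> (Q %| P) = false.
Proof.
move=> nd Qd Pn; apply/negP => /dvdp_leq -/(_ (monics_neq0 Pn)).
by rewrite (monics_size Qd) (monics_size Pn) ltnS leqNgt nd.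
Qed.

(** * Square-free polynomials *)

Definition sqfree P := `[< square_free P >].

Lemma sqfreeP P : reflect (square_free P) (sqfree P).
Proof. exact: asboolP. Qed.

Lemma sqfree_dvd Q P : Q %| P -> sqfree P -> sqfree Q.
Proof.
move=> QP /sqfreeP sP; apply/sqfreeP => u su.
by apply: contra (sP u su) => /dvdp_trans; apply.
Qed.

(** A square dividing [Q P] is either prime to [Q], and then divides [P], or
    has [Q ^+ 2] as a divisor. *)
Lemma sqfreeM_irred Q P : irreducible_poly Q ->
  sqfree (Q * P) = sqfree P && ~~ (Q %| P).
Proof.
move=> irrQ; have Q0 := irredp_neq0 irrQ.
have sQ : size Q != 1%N by case: irrQ => + _; case: size => [|[]].
apply/idP/andP=> [sQP|[/sqfreeP sP nQP]].
  split; first exact: sqfree_dvd (dvdp_mulIr _ _) sQP.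
  apply: contra ((sqfreeP _ sQP) Q sQ) => QP.
  by rewrite expr2 dvdp_mul2l.
apply/sqfreeP => u su; apply/negP => uQP.
have [Qu|nQu] := boolP (Q %| u).
  have : Q ^+ 2 %| Q * P by apply: dvdp_trans uQP; rewrite dvdp_exp2r.
  by rewrite expr2 dvdp_mul2l // (negPf nQP).
have /negP[] := sP u su.
rewrite -(Gauss_dvdpr P (q := Q)) // coprimep_expl // coprimep_sym.
by rewrite irreducible_poly_coprime.
Qed.

Lemma sqfree1 : sqfree 1.
Proof.
apply/sqfreeP => u; apply: contra => /(dvdp_trans (dvdp_mulIl u u)).
by rewrite dvdp1.
Qed.

(** * Counting by square parts *)

(** After division by [gcdp A C], the square of what is left of [A] is prime to
    what is left of [C], hence divides [D]; so nothing is left of [A]. *)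
Lemma dvdp_sqr_sqfree A C D :
  C != 0 -> sqfree D -> A ^+ 2 %| C ^+ 2 * D -> A %| C.
Proof.
move=> C0 /sqfreeP sD; set G := gcdp A C.
have G0 : G != 0 by rewrite gcdp_eq0 negb_and C0 orbT.
have := coprimep_div_gcd (p := A) (q := C); rewrite C0 orbT => /(_ isT).
have AE := divpK (dvdp_gcdl A C); have CE := divpK (dvdp_gcdr A C).
rewrite -/G in AE CE *; move: (A %/ G) (C %/ G) AE CE => A' C' AE CE coA'.
rewrite -{1}AE -{1}CE !exprMn (mulrAC (C' ^+ 2)).
rewrite dvdp_mul2r ?expf_neq0 //.
rewrite Gauss_dvdpr ?coprimep_expl ?coprimep_expr // => A'D.
have [sA'|/sD/negP//] := eqVneq (size A') 1%N.
apply: dvdp_trans (dvdp_gcdr A C); rewrite -/G -{1}AE.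
by rewrite -[X in _ %| X]mul1r dvdp_mul2r // dvdp1 sA'.
Qed.

(** Divide by squares of monic polynomials of positive degree as long as
    possible. *)
Lemma square_part_exists P : P \is monic ->
  exists A B, [/\ A \is monic, sqfree B & P = A ^+ 2 * B].
Proof.
have [m] := ubnP (size P); elim: m P => // m IHm P; rewrite ltnS => szP mP.
have [sP|/sqfreeP/existsNP[u]] := boolP (sqfree P).
  by exists 1, P; rewrite monic1 expr1n mul1r.
move=> /not_implyP[su /negP]; rewrite negbK => uP.
have P0 := monic_neq0 mP.
have u0 : u != 0 by apply: contraNneq P0 => u0; rewrite u0 expr0n dvd0p in uP.
have lu0 : lead_coef u != 0 by rewrite lead_coef_eq0.
pose v := (lead_coef u)^-1 *: u.
have mv : v \is monic by rewrite monicE lead_coefZ mulVf.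
have : v ^+ 2 %| P by rewrite exprZn dvdpZl // expf_neq0 ?invr_eq0.
have sv : (1 < size v)%N.
  by rewrite size_scale ?invr_eq0 // ltn_neqAle eq_sym su size_poly_gt0.
move=> /dvdpP[Q PE]; have mQ : Q \is monic.
  by move: mP; rewrite PE monicMr // monic_exp.
have [|A [B [mA sB QE]]] := IHm Q _ mQ.
  apply: leq_trans szP; rewrite PE size_Mmonic ?monic_exp ?monic_neq0 //.
  have := size_exp v 2; case: (size (v ^+ 2)) (size v) sv => [|?] [|?]; lia.
exists (v * A), B; split; rewrite ?monicMl //.
by rewrite PE QE exprMn mulrC mulrA.
Qed.

Definition square_part P A := (A ^+ 2 %| P) && sqfree (P %/ A ^+ 2).

Lemma square_part_count n P : P \in monics n ->
  (\sum_(k < n.+1) \sum_(A <- monics k) square_part P A = 1)%N.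
Proof.
move=> Pn; have [A [B [mA sB PE]]] := square_part_exists (monics_monic Pn).
have A2P : A ^+ 2 %| P by rewrite PE dvdp_mulIl.
have P0 := monics_neq0 Pn; have A0 := monic_neq0 mA.
have szA : ((size A).-1 < n.+1)%N.
  have AP : A %| P by apply: dvdp_trans A2P; rewrite expr2 dvdp_mulIl.
  by have := dvdp_leq P0 AP; rewrite (monics_size Pn); case: (size A).
have Ak : A \in monics (Ordinal szA).
  by rewrite mem_monics mA /= prednK // size_poly_gt0.
have PA : square_part P A by rewrite /square_part A2P PE mulKp ?expf_neq0.
have uniqA C : C \is monic -> C ^+ 2 %| P -> sqfree (P %/ C ^+ 2) -> C = A.
  move=> mC C2P sC; apply/eqP; rewrite -eqp_monic //; apply/andP; split.
    by apply: dvdp_sqr_sqfree A0 sB _; rewrite -PE.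
  by apply: dvdp_sqr_sqfree (monic_neq0 mC) sC _; rewrite mulrC divpK.
rewrite (bigD1 (Ordinal szA)) //= (bigD1_seq A) ?monics_uniq //= PA.
rewrite big1_seq => [|C /andP[CA Ck]]; last first.
  apply/eqP; rewrite eqb0; apply: contra CA => /andP[C2P sC].
  by rewrite (uniqA C (monics_monic Ck)).
rewrite big1 // => k kA; rewrite big1_seq // => C /= Ck.
apply/eqP; rewrite eqb0; apply: contra kA => /andP[C2P sC].
have CA := uniqA C (monics_monic Ck) C2P sC.
by apply/eqP/val_inj; rewrite /= -CA (monics_size Ck).
Qed.

Definition nb_sqfree n := count sqfree (monics n).

Lemma monics_square_part n :
  (#|F| ^ n = \sum_(k < n.+1 | k.*2 <= n) #|F| ^ k * nb_sqfree (n - k.*2))%N.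
Proof.
rewrite -size_monics -sum1_size.
rewrite (eq_big_seq _ (fun P Pn => esym (square_part_count Pn))).
rewrite exchange_big /=.
rewrite [RHS]big_mkcond; apply: eq_bigr => k _; rewrite exchange_big /=.
have A2 A : A \in monics k -> A ^+ 2 \in monics k.*2.
  rewrite -addnn expr2 => Ak; rewrite mem_monicsM //.
have [kn|nk] := leqP.
  have -> : monics n = monics (k.*2 + (n - k.*2)) by rewrite subnKC.
  rewrite -size_monics -sum1_size big_distrl; apply: eq_big_seq => A Ak /=.
  have A20 := monics_neq0 (A2 A Ak); rewrite mul1n /nb_sqfree -sum1_count.
  transitivity (\sum_(P <- monics (k.*2 + (n - k.*2)) | (A ^+ 2 %| P)%R)
                  sqfree (P %/ A ^+ 2)%R)%N.
    rewrite [RHS]big_mkcond; apply: eq_bigr => P _.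
    by rewrite /square_part; case: ifP.
  rewrite (big_monics_dvd _ _ _ (A2 A Ak)) [RHS]big_mkcond.
  by apply: eq_bigr => P _; rewrite mulKp //; case: sqfree.
apply: big1_seq => A /A2 A2k; apply: big1_seq => P /(monics_ndvd nk A2k).
by rewrite /square_part => ->.
Qed.

Lemma nb_sqfree0 : nb_sqfree 0 = 1%N.
Proof. by rewrite /nb_sqfree monics0 /= sqfree1. Qed.

Lemma nb_sqfree1 : nb_sqfree 1 = #|F|.
Proof.
rewrite -[RHS]expn1 monics_square_part big_mkcond !big_ord_recl big_ord0 /=.
by rewrite mul1n !addn0.
Qed.

(** In the count by square parts, the terms with [A] of positive degree in
    degree [n.+2] are [#|F|] times those of degree [n]: there are
    [#|F| ^ n.+1] polynomials that are not square-free. *)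
Lemma nb_sqfreeSS n : (nb_sqfree n.+2 + #|F| ^ n.+1 = #|F| ^ n.+2)%N.
Proof.
rewrite [RHS]monics_square_part big_mkcond big_ord_recl /= mul1n; congr addn.
rewrite expnS monics_square_part big_ord_recr /=.
rewrite (_ : (_ <= _)%N = false) ?addn0; last by rewrite /bump /=; lia.
rewrite big_distrr big_mkcond; apply: eq_bigr => k _ /=.
by rewrite /bump /= add1n doubleS !ltnS !subSS expnS mulnA.
Qed.

(** * Irreducible factors of square-free polynomials *)

Lemma monics_dvdE n P Q : P \in monics n -> Q \in monics n ->
  (Q %| P) = (Q == P).
Proof.
move=> Pn Qn; rewrite -eqp_monic ?(monics_monic Pn) ?(monics_monic Qn) //.
apply/idP/idP => [QP|/andP[]//].
by rewrite -(dvdp_size_eqp QP) (monics_size Pn) (monics_size Qn).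
Qed.

Definition irr_monics d := [seq Q <- monics d | irreducibleb Q].

Lemma irr_monics_irr d Q : Q \in irr_monics d -> irreducible_poly Q.
Proof. by rewrite mem_filter => /andP[/irreducibleP]. Qed.

Lemma irr_monics_monics d Q : Q \in irr_monics d -> Q \in monics d.
Proof. by rewrite mem_filter => /andP[]. Qed.

Lemma irr_monics1 : irr_monics 1 = monics 1.
Proof.
apply/all_filterP/allP => Q Q1; apply/irreducibleP; split=> [|u su uQ].
  by rewrite (monics_size Q1).
have := dvdp_leq (monics_neq0 Q1) uQ.
have : u != 0 by apply: contraTneq uQ => ->; rewrite dvd0p (monics_neq0 Q1).
rewrite -size_poly_gt0 -(dvdp_size_eqp uQ) (monics_size Q1).
by case: (size u) su => [|[|[]]].
Qed.

Lemma nb_irr_factorsE d P :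
  nb_irr_factors d P = (\sum_(Q <- irr_monics d) (Q %| P)%R)%N.
Proof.
rewrite /nb_irr_factors -sum1dep_card.
transitivity (\sum_(Q : {poly_d.+1 F} | [&& polyn Q \is monic, size Q == d.+1
                    & irreducibleb (polyn Q) && (polyn Q %| P)%R]) 1)%N => //.
rewrite (big_bounded_monic _ _ (fun Q => irreducibleb Q && (Q %| P))
                           (fun=> 1%N)).
rewrite big_filter big_mkcondr.
by apply: eq_bigr => Q _; case: (_ %| _).
Qed.

(** Write a square-free multiple of [Q] as [Q P]; then [P] is square-free and
    prime to [Q]. *)
Lemma sum_sqfree_dvd d n Q (f : {poly F} -> nat) : Q \in irr_monics d ->
  (\sum_(P <- monics (d + n) | sqfree P) (Q %| P)%R * f P
   = \sum_(P <- monics n | sqfree P) ~~ (Q %| P)%R * f (Q * P)%R)%N.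
Proof.
move=> Qd; have irrQ := irr_monics_irr Qd.
transitivity (\sum_(P <- monics (d + n) | (Q %| P)%R) sqfree P * f P)%N.
  rewrite big_mkcond [RHS]big_mkcond; apply: eq_bigr => P _.
  by case: sqfree; case: (_ %| _).
rewrite (big_monics_dvd _ _ _ (irr_monics_monics Qd)) [RHS]big_mkcond.
apply: eq_bigr => P _; rewrite sqfreeM_irred //.
by case: sqfree; case: (_ %| _).
Qed.

Definition sum_irr_factors d n :=
  (\sum_(P <- monics n | sqfree P) nb_irr_factors d P)%N.

(** The pairs are ordered, so each product of two linear factors counts
    twice. *)
Definition sum_linear_pairs n :=
  (\sum_(P <- monics n | sqfree P)
     nb_irr_factors 1 P * (nb_irr_factors 1 P).-1)%N.

Lemma sum_irr_factorsE d n : sum_irr_factors d n =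
  (\sum_(Q <- irr_monics d) \sum_(P <- monics n | sqfree P) (Q %| P)%R)%N.
Proof.
by rewrite exchange_big; apply: eq_bigr => P _; rewrite nb_irr_factorsE.
Qed.

Lemma nb_linear_pairsE P : (nb_irr_factors 1 P * (nb_irr_factors 1 P).-1 =
  \sum_(Q <- monics 1) \sum_(L <- monics 1 | L != Q) (Q %| P)%R * (L %| P)%R)%N.
Proof.
rewrite nb_irr_factorsE irr_monics1 big_distrl; apply: eq_big_seq => Q Q1 /=.
case QP: (Q %| P); last by rewrite mul0n big1 // => L _; rewrite mul0n.
rewrite mul1n (bigD1_seq Q) ?monics_uniq //= QP add1n /=.
by apply: eq_bigr => L _; rewrite mul1n.
Qed.

Lemma sum_linear_pairsE n : sum_linear_pairs n =
  (\sum_(Q <- monics 1) \sum_(L <- monics 1 | L != Q)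
     \sum_(P <- monics n | sqfree P) (Q %| P)%R * (L %| P)%R)%N.
Proof.
rewrite /sum_linear_pairs (eq_bigr _ (fun P _ => nb_linear_pairsE P)).
rewrite exchange_big; apply: eq_bigr => Q _ /=.
by rewrite exchange_big.
Qed.

Lemma sum_irr_factors_small d n : (n < d)%N -> sum_irr_factors d n = 0%N.
Proof.
move=> nd; rewrite sum_irr_factorsE big1_seq // => Q /= /irr_monics_monics Qd.
by rewrite big1_seq // => P /andP[_ Pn]; rewrite (monics_ndvd nd Qd Pn).
Qed.

Lemma sum_linear_pairs0 : sum_linear_pairs 0 = 0%N.
Proof.
rewrite sum_linear_pairsE big1_seq // => Q /= Q1; rewrite big1 // => L _.
by rewrite big1_seq // => P /andP[_ P0]; rewrite (monics_ndvd _ Q1 P0).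
Qed.

Lemma nb_sqfree_sum n : nb_sqfree n = (\sum_(P <- monics n | sqfree P) 1)%N.
Proof. by rewrite sum1_count. Qed.

(** For a given [Q], each square-free [P] of degree [n] is either divisible by
    [Q] or the cofactor of a square-free multiple of [Q] of degree [d + n]. *)
Lemma sum_irr_factors_rec d n :
  (sum_irr_factors d (d + n) + sum_irr_factors d n
   = size (irr_monics d) * nb_sqfree n)%N.
Proof.
rewrite !sum_irr_factorsE -big_split -sum1_size big_distrl /=.
apply: eq_big_seq => Q Qd; have := sum_sqfree_dvd n (fun=> 1%N) Qd.
under eq_bigr do rewrite muln1.
move=> ->; rewrite -big_split mul1n nb_sqfree_sum /=.
by apply: eq_bigr => P _; case: (_ %| _).
Qed.

(** For distinct linear [Q] and [L], the polynomial [L] divides [Q * P] exactly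
    when it divides [P]; and a given [L] occurs with [#|F|.-1] choices of
    [Q]. *)
Lemma sum_linear_pairs_rec n :
  (sum_linear_pairs n.+1 + sum_linear_pairs n
   = #|F|.-1 * sum_irr_factors 1 n)%N.
Proof.
rewrite !sum_linear_pairsE -big_split /=.
transitivity (\sum_(Q <- monics 1) \sum_(L <- monics 1 | L != Q)
  \sum_(P <- monics n | sqfree P) (L %| P)%R)%N.
  apply: eq_big_seq => Q Q1; rewrite -big_split /=.
  rewrite big_seq_cond [RHS]big_seq_cond; apply: eq_bigr => L /andP[L1 LQ].
  have iQ : Q \in irr_monics 1 by rewrite irr_monics1.
  rewrite -add1n (sum_sqfree_dvd _ _ iQ) -big_split /=; apply: eq_bigr => P _.
  rewrite Gauss_dvdpr; first by case: (Q %| P)%R; rewrite ?mul1n ?mul0n ?addn0.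
  rewrite irreducible_poly_coprime; first by rewrite (monics_dvdE Q1 L1).
  by apply: (@irr_monics_irr 1); rewrite irr_monics1.
rewrite (exchange_big_dep predT) //= sum_irr_factorsE irr_monics1 big_distrr /=.
apply: eq_big_seq => L L1; rewrite big_const_seq iter_addn_0 mulnC.
congr muln; rewrite -[#|F|]expn1 -size_monics -(count_predC (pred1 L)).
rewrite (count_uniq_mem _ (monics_uniq 1)) L1 /=.
by apply: eq_count => Q /=; rewrite eq_sym.
Qed.

(** Without a root a quadratic polynomial is irreducible; with a root it is a
    product of two linear factors, distinct by square-freeness. *)
Lemma nb_linear_factors_quadratic P : P \in monics 2 -> sqfree P ->
  (nb_irr_factors 1 P + 2 * irreducibleb P = 2)%N.
Proof.
move=> P2 sP; rewrite nb_irr_factorsE irr_monics1.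
case: (irreducibleP P) => [irrP|redP].
  rewrite big1_seq // => Q /= Q1; apply/eqP; rewrite eqb0; apply/negP => QP.
  have /eqp_size : Q %= P by apply: irrP QP; rewrite (monics_size Q1).
  by rewrite (monics_size Q1) (monics_size P2).
have [a Pa] : exists a, root P a.
  apply: contra_notP redP => /forallNP noroot.
  by apply: cubic_irreducible => [|x]; [rewrite (monics_size P2)|apply/negP].
have La : 'X - a%:P \in monics 1.
  by rewrite mem_monics monicXsubC size_XsubC eqxx.
move: Pa; rewrite root_factor_theorem => /dvdpP[M PE]; rewrite mulrC in PE.
have M1 : M \in monics 1 by rewrite -(mem_monicsM _ _ La) -PE.
have irrL := irredp_XsubC a.
have aM : 'X - a%:P != M.
  by move: sP; rewrite PE sqfreeM_irred // (monics_dvdE M1 La) => /andP[].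
have count_monic1 A : A \in monics 1 -> (\sum_(Q <- monics 1) (Q == A) = 1)%N.
  move=> A1; rewrite (bigD1_seq A) ?monics_uniq //= eqxx big1 // => Q.
  by move/negPf->.
rewrite addn0; transitivity (\sum_(Q <- monics 1) (Q == 'X - a%:P)%R
                             + \sum_(Q <- monics 1) (Q == M))%N;
  last by rewrite !count_monic1.
rewrite -big_split; apply: eq_big_seq => Q Q1 /=.
have irrQ : irreducible_poly Q.
  by apply: (@irr_monics_irr 1); rewrite irr_monics1.
have [->|nQL] := eqVneq Q ('X - a%:P).
  by rewrite PE dvdp_mulIl (negPf aM).
rewrite PE Gauss_dvdpr ?(monics_dvdE M1 Q1) //.
by rewrite irreducible_poly_coprime // (monics_dvdE La Q1).
Qed.

Lemma irreducible_sqfree Q : irreducible_poly Q -> sqfree Q.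
Proof.
move=> irrQ; rewrite -[Q]mulr1 sqfreeM_irred // sqfree1 dvdp1.
by case: irrQ; case: (size Q) => [|[]].
Qed.

(** Average [nb_linear_factors_quadratic] over the square-free quadratic
    polynomials, which by [sum_irr_factors_rec] have on average one linear
    factor. *)
Lemma size_irr_monics2 : (2 * size (irr_monics 2) = #|F| * #|F|.-1)%N.
Proof.
have := sum_irr_factors_rec 1 1; have := sum_irr_factors_rec 1 0.
rewrite (@sum_irr_factors_small 1 0) // irr_monics1 size_monics expn1.
rewrite nb_sqfree0 nb_sqfree1 /=.
have sf2 : nb_sqfree 2 = (#|F| * #|F|.-1)%N.
  by have := nb_sqfreeSS 0; case: #|F| => // m /=; lia.
have : (sum_irr_factors 1 2 + 2 * size (irr_monics 2) = 2 * nb_sqfree 2)%N.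
  rewrite nb_sqfree_sum -sum1_size big_filter /sum_irr_factors !big_distrr /=.
  rewrite [X in (_ + X)%N](_ : _ =
      \sum_(P <- monics 2 | sqfree P) 2 * irreducibleb P)%N.
    rewrite -big_split /= big_seq_cond [RHS]big_seq_cond.
    by apply: eq_bigr => P /andP[P2 sP]; rewrite nb_linear_factors_quadratic.
  rewrite [RHS]big_mkcond [LHS]big_mkcond; apply: eq_bigr => Q _.
  case: (irreducibleP Q) => [irrQ|_]; last by rewrite muln0 if_same.
  by rewrite irreducible_sqfree.
rewrite sf2 -[(1 + 0)%N]/1%N -[(1 + 1)%N]/2%N; case: #|F| => [|m] /=; lia.
Qed.
End MonicPolynomials.

(** * The explicit formula *)

(** [(-1) ^ m * recip_coef m] is the coefficient of [T ^ m] in the power series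
    of [1 / ((1 + T) ^ 2 * (1 + T ^ 2))]. *)
Definition recip_coef m := (m %/ 4 + (m + 3) %/ 4 + 1)%N.

(** The denominator expands to [1 + 2 T + 2 T ^ 2 + 2 T ^ 3 + T ^ 4]; its odd
    terms change sides because the signs of the coefficients alternate. *)
Lemma recip_coef_rec m :
  (recip_coef (m + 4) + 2 * recip_coef (m + 2) + recip_coef m
   = 2 * recip_coef (m + 3) + 2 * recip_coef (m + 1))%N.
Proof. rewrite /recip_coef; lia. Qed.

Lemma seq_bE m : seq_b m.+1 = recip_coef m.+1.
Proof.
rewrite /seq_b /recip_coef /=.
have := ltn_pmod m (isT : (0 < 4)%N); have := divn_eq m 4.
by case: (m %% 4)%N => [|[|[|[|]]]] //=; lia.
Qed.

Lemma seq_aE m : seq_a m.+2 = (recip_coef m.+1 + recip_coef m)%N.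
Proof.
rewrite /seq_a /recip_coef /=.
have := ltn_pmod m.+1 (isT : (0 < 4)%N); have := divn_eq m.+1 4.
by case: (m.+1 %% 4)%N => [|[|[|[|]]]] //=; lia.
Qed.

Lemma natr_recip_coef_rec (K : fieldType) m :
  (recip_coef (m + 4))%:R = 2 * (recip_coef (m + 3))%:R
    - 2 * (recip_coef (m + 2))%:R + 2 * (recip_coef (m + 1))%:R
    - (recip_coef m)%:R :> K.
Proof.
move: (recip_coef_rec m); move: (recip_coef (m + 4)) (recip_coef (m + 3)).
move: (recip_coef (m + 2)) (recip_coef (m + 1)) (recip_coef m).
move=> c2 c1 c0 c4 c3.
rewrite !mul2n -!addnn => /(congr1 (fun k => k%:R : K)).
rewrite !natrD => /eqP; rewrite eq_sym -subr_eq -subr_eq => /eqP <-.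
by ring.
Qed.

Section ClosedForm.
Variables (K : fieldType) (q : K) (s e : nat -> K).
Hypothesis q0 : q != 0.
Hypothesis sSS : forall n, s n.+2 = q ^+ n.+2 - q ^+ n.+1.
Hypothesis s1 : s 1%N = q.
Hypotheses (e0 : e 0%N = 0) (e1 : e 1%N = 0) (e2 : e 2 = 0) (e3 : e 3 = 1).
Hypothesis eS : forall n,
  e n.+4 + 2 * e n.+3 + 2 * e n.+2 + 2 * e n.+1 + e n = s n.+1.

Let eSE n : e n.+4 = s n.+1 - 2 * e n.+3 - 2 * e n.+2 - 2 * e n.+1 - e n.
Proof. by rewrite -eS; ring. Qed.

(** The factor [1 - q T] turns the source [s] into a polynomial, so from some
    point on the left-hand side obeys a homogeneous recurrence, which the
    right-hand side shares. *)
Lemma closed_form_step n : e n.+1.+4 - q * e n.+4 =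
  (-1) ^+ n * ((recip_coef n.+2)%:R - q * (recip_coef n)%:R).
Proof.
have [m] := ubnP n; elim: m n => // m IHm [|[|[|[|n]]]]; rewrite ltnS => nm.
- rewrite !(eSE, sSS, s1, e0, e1, e2, e3).
  by rewrite -[recip_coef 2]/2%N -[recip_coef 0]/1%N; ring.
- rewrite !(eSE, sSS, s1, e0, e1, e2, e3).
  by rewrite -[recip_coef 3]/2%N -[recip_coef 1]/2%N; ring.
- rewrite !(eSE, sSS, s1, e0, e1, e2, e3).
  by rewrite -[recip_coef 4]/3%N -[recip_coef 2]/2%N; ring.
- rewrite !(eSE, sSS, s1, e0, e1, e2, e3).
  by rewrite -[recip_coef 5]/4%N -[recip_coef 3]/2%N; ring.
have IH3 := IHm n.+3; have IH2 := IHm n.+2; have IH1 := IHm n.+1.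
have IH0 := IHm n.
have b2 := natr_recip_coef_rec K n.+2; have b0 := natr_recip_coef_rec K n.
rewrite !(addn4, addn3, addn2, addn1) in b2 b0.
rewrite (eSE n.+1.+4) [in q * _](eSE n.+4) !sSS.
transitivity (- 2 * (e n.+4.+4 - q * e n.+3.+4)
  - 2 * (e n.+3.+4 - q * e n.+2.+4) - 2 * (e n.+2.+4 - q * e n.+1.+4)
  - (e n.+1.+4 - q * e n.+4)).
  by rewrite !exprS; ring.
rewrite IH3 ?IH2 ?IH1 ?IH0; try lia.
by rewrite b2 b0 !exprS; ring.
Qed.

Lemma closed_form m : e m.+4 / q ^+ m.+2 =
  \sum_(1 <= i < m.+2) (-1) ^+ i.+1 * (seq_a i)%:R / q ^+ i
  - (-1) ^+ m * (seq_b m.+1)%:R / q ^+ m.+2.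
Proof.
elim: m => [|m IHm].
  rewrite big_nat1 !(eSE, s1, e0, e1, e2, e3).
  rewrite -[seq_a 1]/1%N -[seq_b 1]/2%N !exprS expr0.
  by field.
have /eqP := closed_form_step m; rewrite subr_eq => /eqP ->.
rewrite big_nat_recr //=.
have -> : \sum_(1 <= i < m.+2) (-1) ^+ i.+1 * (seq_a i)%:R / q ^+ i
  = e m.+4 / q ^+ m.+2 + (-1) ^+ m * (seq_b m.+1)%:R / q ^+ m.+2.
  by rewrite IHm subrK.
rewrite seq_aE !seq_bE (natrD _ (recip_coef m.+1)).
move: (recip_coef _) (recip_coef _) => b b'; rewrite !exprS.
by field; rewrite expf_neq0.
Qed.
End ClosedForm.

(** * The limit *)

Lemma damped_recurrence_bounded (R : realType) (k : nat) (a K : R) (x : R^nat) :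
  0 <= a < 1 -> (0 < k)%N -> (forall n, `|x (n + k)%N + a * x n| <= K) ->
  exists B, forall n, `|x n| <= B.
Proof.
move=> /andP[a0 a1] k0 xK; have K0 : 0 <= K by apply: le_trans (xK 0%N).
exists (\sum_(i < k) `|x i| + K / (1 - a)) => n.
have Ka : 0 <= K / (1 - a) by rewrite divr_ge0 // subr_ge0 ltW.
have [m] := ubnP n; elim: m n => // m IHm n; rewrite ltnS => nm.
have [nk|kn] := ltnP n k.
  rewrite (bigD1 (Ordinal nk)) //= -addrA lerDl.
  by rewrite addr_ge0 // sumr_ge0.
have [p np] : exists p, n = (p + k)%N by exists (n - k)%N; lia.
rewrite np -[x (p + k)%N](addrK (a * x p)).
apply: (le_trans (ler_normB _ _)); rewrite normrM (ger0_norm a0).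
have xp : a * `|x p| <= a * (\sum_(i < k) `|x i| + K / (1 - a)).
  by rewrite ler_wpM2l // IHm //; lia.
apply: (le_trans (lerD (xK p) xp)).
have -> : K = K / (1 - a) * (1 - a) by rewrite divfK // subr_eq0 gt_eqF.
have S0 : 0 <= \sum_(i < k) `|x i| by apply: sumr_ge0.
rewrite mulfK ?subr_eq0 ?gt_eqF //.
by move: (K / (1 - a)) (\sum_(i < k) _) S0 => L S S0; nra.
Qed.

(** Every [k] steps a bound on [x] is multiplied by [a], up to an error that
    tends to [0]; after [j] rounds the initial bound [B] has become
    [a ^+ j * B]. *)
Lemma damped_recurrence_cvg0 (R : realType) (k : nat) (a : R) (x : R^nat) :
  0 <= a < 1 -> (0 < k)%N ->
  x (n + k)%N + a * x n @[n --> \oo] --> (0 : R) -> x @ \oo --> (0 : R).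
Proof.
move=> a01 k0 y0; have /andP[a0 a1] := a01.
have [B xB] : exists B, forall n, `|x n| <= B.
  have y_cvg : cvgn (fun n => x (n + k)%N + a * x n) by apply/cvg_ex; exists 0.
  have [M [_ yM]] := cvg_seq_bounded y_cvg.
  apply: (@damped_recurrence_bounded _ k a (M + 1)) => // n.
  by apply: (yM (M + 1)) => //; rewrite ltrDl.
have B0 : 0 <= B by apply: le_trans (xB 0%N).
have step eps : 0 < eps -> forall j, exists N, forall n, (N <= n)%N ->
    `|x n| <= a ^+ j * B + eps.
  move=> eps0; elim=> [|j [N xN]].
    by exists 0%N => n _; rewrite expr0 mul1r ler_wpDr // ltW.
  (* An error of [eps * (1 - a)] per round makes [eps] a fixed point of the
     recurrence of bounds. *)
  have e1 : 0 < eps * (1 - a) by rewrite mulr_gt0 // subr_gt0.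
  have /cvgrPdist_le /(_ _ e1) [N' _ yN'] := y0.
  exists (maxn N N' + k)%N => n nN.
  have [m mn] : exists m, n = (m + k)%N by exists (n - k)%N; lia.
  have := yN' m; rewrite /= sub0r normrN => /(_ _) ym.
  have {}ym : `|x (m + k)%N + a * x m| <= eps * (1 - a) by apply: ym => /=; lia.
  have xm : `|x m| <= a ^+ j * B + eps by apply: xN; lia.
  rewrite mn -[x (m + k)%N](addrK (a * x m)).
  apply: (le_trans (ler_normB _ _)); rewrite normrM (ger0_norm a0).
  apply: (@le_trans _ _ (eps * (1 - a) + a * (a ^+ j * B + eps))).
    by rewrite lerD // ler_wpM2l.
  by rewrite exprS; lra.
apply/cvgrPdist_le => eps eps0.
have e2 : 0 < eps / 2 by rewrite divr_gt0.
have [j ajB] : exists j, a ^+ j * B <= eps / 2.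
  have : a ^+ j * B @[j --> \oo] --> (0 : R).
    rewrite -(mul0r B); apply: cvgMl; apply: cvg_expr.
    by rewrite ger0_norm.
  move=> /cvgrPdist_le /(_ _ e2) [j _ /(_ j (leqnn _))].
  rewrite /= sub0r normrN.
  by move=> /ler_normlW ?; exists j.
have [N xN] := step _ e2 j; exists N => // n /= Nn; rewrite sub0r normrN.
by have := xN n Nn; lra.
Qed.

Lemma damped_recurrence_cvg (R : realType) (k : nat) (a l : R) (x : R^nat) :
  0 <= a < 1 -> (0 < k)%N ->
  x (n + k)%N + a * x n @[n --> \oo] --> l -> x @ \oo --> l / (1 + a).
Proof.
move=> a01 k0 xl; have a1 : 1 + a != 0 by case/andP: a01 => *; lra.
have : (fun n => x n - l / (1 + a)) @ \oo --> (0 : R).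
  apply: (damped_recurrence_cvg0 a01 k0).
  rewrite -(subrr l); set f := (X in X @ _ --> _).
  rewrite (_ : f = fun n => x (n + k)%N + a * x n - l).
    by apply: cvgB => //; apply: cvg_cst.
  by apply/funext => n; rewrite /f; field.
by move=> /cvg_sub0; apply; apply: cvg_cst.
Qed.

(** In terms of the backward shift [T], dividing by [q ^ n] gives a recurrence
    whose operator is the product of [1 + T / q], applied in [y] and again in
    [z], and of [1 + (T / q) ^ 2]. *)
Lemma closed_form_cvg (R : realType) (q : R) (s e : nat -> R) : 1 < q ->
  (forall n, s n.+2 = q ^+ n.+2 - q ^+ n.+1) ->
  (forall n, e n.+4 + 2 * e n.+3 + 2 * e n.+2 + 2 * e n.+1 + e n = s n.+1) ->
  e n.+2 / q ^+ n @[n --> \oo] -->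
    1 / q * ((1 - 1 / q) / ((1 + 1 / q) ^+ 2 * (1 + 1 / q ^+ 2))).
Proof.
move=> q1 sSS eS; have q_gt0 : 0 < q by lra.
have q0 : q != 0 by lra.
pose x n : R := e n / q ^+ n.
pose y n := x (n + 1)%N + q^-1 * x n.
pose z n := y (n + 1)%N + q^-1 * y n.
have qV : 0 <= q^-1 < 1 by rewrite invr_ge0 ltW //= invf_lt1.
have qV2 : 0 <= q^-1 ^+ 2 < 1.
  by rewrite exprn_ge0 ?expr_lt1 //; case/andP: qV.
have z_lim : z (n + 2)%N + q^-1 ^+ 2 * z n @[n --> \oo] --> (q - 1) / q ^+ 4.
  rewrite -(cvg_shiftn 1) /=.
  rewrite (_ : (fun n => _) = cst ((q - 1) / q ^+ 4)); first exact: cvg_cst.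
  apply/funext => n /=.
  have := eS n.+1; rewrite sSS /z /y /x !addn1 !addn2 => eSn.
  have -> : q - 1 = (q ^+ n.+2 - q ^+ n.+1) / q ^+ n.+1.
    by rewrite !exprS; field; rewrite expf_neq0.
  by rewrite -eSn !exprS; field; rewrite q0 expf_neq0.
have y_lim : y @ \oo --> (q - 1) / q ^+ 4 / (1 + q^-1 ^+ 2) / (1 + q^-1).
  apply: (@damped_recurrence_cvg _ 1 _ _ y qV) => //.
  exact: (@damped_recurrence_cvg _ 2 _ _ z qV2 isT z_lim).
have x_lim := @damped_recurrence_cvg _ 1 _ _ x qV isT y_lim.
have {}x_lim : x (n + 2)%N @[n --> \oo] -->
    (q - 1) / q ^+ 4 / (1 + q^-1 ^+ 2) / (1 + q^-1) / (1 + q^-1).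
  by rewrite (cvg_shiftn 2 x).
have -> : (fun n => e n.+2 / q ^+ n) = (fun n => q ^+ 2 * x (n + 2)%N).
  apply/funext => n; rewrite /x addn2 !exprS expr0.
  by field; rewrite expf_neq0.
set l := (X in _ --> X).
have -> : l = q ^+ 2 *
    ((q - 1) / q ^+ 4 / (1 + q^-1 ^+ 2) / (1 + q^-1) / (1 + q^-1)).
  rewrite /l; field.
  by rewrite q0 /=; apply/andP; split; nra.
exact: cvgMr.
Qed.

(** * The expected excess *)

Section ExpectedExcess.
Variables (R : realType) (F : finFieldType).
Let q : R := #|F|%:R.

Let q_gt1 : 1 < q.
Proof. by rewrite ltr1n card_finNzRing_gt1. Qed.

Let q0 : q != 0.
Proof. by move: q_gt1; lra. Qed.

Let q1 : q - 1 != 0.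
Proof. by move: q_gt1; lra. Qed.

Lemma natr_pred_card : (#|F|.-1)%:R = q - 1.
Proof. by rewrite -subn1 natrB // ltnW // card_finNzRing_gt1. Qed.

Definition total_excess n : R :=
  (sum_irr_factors F 2 n)%:R - (sum_linear_pairs F n)%:R / 2.

Lemma sum_excess n :
  \sum_(P in monic_square_free F n) excess R P = total_excess n.
Proof.
transitivity (\sum_(P : {poly_n.+1 F} | [&& polyn P \is monic, size P == n.+1
                    & sqfree (polyn P)]) excess R (polyn P)).
  by apply: eq_bigl => P; rewrite inE.
rewrite (big_bounded_monic _ _ (@sqfree F) (@excess R F)) sumrB -natr_sum.
congr (_ - _); rewrite natr_sum big_distrl; apply: eq_bigr => P _ /=.
by rewrite -[_.-1]ffactn1 -ffactnS -bin_ffact natrM mulfK ?pnatr_eq0.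
Qed.

Lemma card_monic_square_free n : #|monic_square_free F n| = nb_sqfree F n.
Proof.
rewrite -sum1_card nb_sqfree_sum.
rewrite -(big_bounded_monic _ _ (@sqfree F) (fun=> 1%N)).
by apply: eq_bigl => P; rewrite inE.
Qed.

Lemma natr_nb_sqfreeSS n : (nb_sqfree F n.+2)%:R = q ^+ n.+2 - q ^+ n.+1.
Proof.
have /(congr1 (fun m => m%:R : R)) := nb_sqfreeSS F n.
by rewrite natrD !natrX => <-; rewrite addrK.
Qed.

(** The factor [q * (q - 1)] is twice the number of irreducible quadratic
    polynomials, and also the cofactor of [q ^ n] in the number of square-free
    polynomials of degree [n.+2]. *)
Definition normalized_excess n := total_excess n / (q * (q - 1)).

Lemma natr_sum_quadratic n : (sum_irr_factors F 2 n.+2)%:R =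
  q * (q - 1) / 2 * (nb_sqfree F n)%:R - (sum_irr_factors F 2 n)%:R :> R.
Proof.
have -> : q * (q - 1) / 2 = (size (irr_monics F 2))%:R.
  have /(congr1 (fun m => m%:R : R)) := size_irr_monics2 F.
  by rewrite !natrM natr_pred_card => <-; field.
by rewrite -natrM -sum_irr_factors_rec natrD addrK add2n.
Qed.

Lemma natr_sum_linear n : (sum_irr_factors F 1 n.+1)%:R =
  q * (nb_sqfree F n)%:R - (sum_irr_factors F 1 n)%:R :> R.
Proof.
have -> : q = (size (irr_monics F 1))%:R.
  by rewrite irr_monics1 size_monics expn1.
by rewrite -natrM -sum_irr_factors_rec natrD addrK add1n.
Qed.

Lemma natr_sum_linear_pairs n : (sum_linear_pairs F n.+1)%:R =
  (q - 1) * (sum_irr_factors F 1 n)%:R - (sum_linear_pairs F n)%:R :> R.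
Proof.
by rewrite -natr_pred_card -natrM -sum_linear_pairs_rec natrD addrK.
Qed.

Lemma normalized_excess_rec n :
  normalized_excess n.+4 + 2 * normalized_excess n.+3
  + 2 * normalized_excess n.+2 + 2 * normalized_excess n.+1
  + normalized_excess n = (nb_sqfree F n.+1)%:R.
Proof.
rewrite /normalized_excess /total_excess.
rewrite !(natr_sum_quadratic, natr_sum_linear_pairs, natr_sum_linear).
by field; apply/andP.
Qed.

Lemma normalized_excess_small :
  [/\ normalized_excess 0 = 0, normalized_excess 1 = 0,
      normalized_excess 2 = 0 & normalized_excess 3 = 1].
Proof.
rewrite /normalized_excess /total_excess.
rewrite !(natr_sum_quadratic, natr_sum_linear_pairs, natr_sum_linear).
rewrite !sum_irr_factors_small // sum_linear_pairs0 nb_sqfree0 nb_sqfree1 -/q.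
by split; field; apply/andP.
Qed.

Lemma expected_excessE n :
  expected_excess R F n.+2 = normalized_excess n.+2 / q ^+ n.
Proof.
rewrite /expected_excess sum_excess card_monic_square_free natr_nb_sqfreeSS.
have -> : q ^+ n.+2 - q ^+ n.+1 = q ^+ n * (q * (q - 1)).
  by rewrite !exprS; ring.
by rewrite /normalized_excess invfM mulrA mulrAC.
Qed.

End ExpectedExcess.

Theorem theorem2p4 (R : realType) (q : nat) (F : finFieldType)
    (card_F : #|F| = q) :
  (expected_excess R F n @[n --> \oo] -->
     1 / q%:R *
     ((1 - 1 / q%:R) / ((1 + 1 / q%:R) ^+ 2 * (1 + 1 / q%:R ^+ 2)) : R))
  /\ [/\ expected_excess R F 2 = 0,
         expected_excess R F 3 = 1 / q%:R
       & forall n : nat, (4 <= n)%N ->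
         expected_excess R F n =
           (\sum_(1 <= i < (n - 3).+1)
              (-1) ^+ i.+1 * (seq_a i)%:R / q%:R ^+ i)
           - (-1) ^+ n * (seq_b (n - 3))%:R / q%:R ^+ (n - 2)].
Proof.
have q_gt1 : 1 < q%:R :> R by rewrite -card_F ltr1n card_finNzRing_gt1.
have q0 : q%:R != 0 :> R by rewrite gt_eqF // (lt_trans ltr01).
have E n : expected_excess R F n.+2 = normalized_excess R F n.+2 / q%:R ^+ n.
  by rewrite expected_excessE card_F.
have s1 : (nb_sqfree F 1)%:R = q%:R :> R by rewrite nb_sqfree1 card_F.
have sSS n : (nb_sqfree F n.+2)%:R = q%:R ^+ n.+2 - q%:R ^+ n.+1 :> R.
  by rewrite natr_nb_sqfreeSS card_F.
have [e0 e1 e2 e3] := normalized_excess_small R F.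
have eS := normalized_excess_rec R F.
split.
  rewrite -(cvg_shiftn 2).
  under [X in X @ _]eq_fun do rewrite addn2 E.
  exact: (@closed_form_cvg R _ (fun n => (nb_sqfree F n)%:R)).
split=> [||[|[|[|[|n]]]] // _]; rewrite E.
- by rewrite e2 mul0r.
- by rewrite e3 expr1.
rewrite !subSS !subn0.
rewrite (closed_form (s := fun n => (nb_sqfree F n)%:R) q0 sSS s1) //.
by rewrite !exprS !mulN1r !opprK.
Qed.
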